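(* Let $(X,f_{1,\infty})$ be a non-autonomous discrete dynamical system. Consider the discrete topology on the set $\mathcal{F}=\{f_1^n:n\in\mathbb{N}\}$. Then (i) the NDDS $(X,f_{1,\infty})$ is very strongly transitive if and only if the generic dynamical system $(X,\mathcal{F})$ is very strongly transitive; (ii) the NDDS $(X,f_{1,\infty})$ is topologically mixing if and only if the generic dynamical system $(X,\mathcal{F})$ is topologically mixing.
   Context: $\mathbb{N}=\{1,2,3,\dots\}$. A non-autonomous discrete dynamical system (NDDS) is a pair $(X,f_{1,\infty})$ where $X$ is a compact metric space and $f_{1,\infty}=(f_n)_{n\in\mathbb{N}}$ is a sequence of continuous maps $f_n:X\to X$; $f_1^n:=f_n\circ\cdots\circ f_1$. The NDDS is very strongly transitive if for every nonempty open $V\subset X$ there is $k\in\mathbb{N}$ with $\bigcup_{n=1}^k f_1^n(V)=X$; topologically mixing if for all nonempty open $U,V\subset X$ there is $k\in\mathbb{N}$ with $f_1^n(U)\cap V\neq\emptyset$ for all $n\geq k$. A generic dynamical system (GDS) is a pair $(X,\mathcal{F})$ where $X$ is a compact metric space and $\mathcal{F}$ is a collection of continuous maps $X\to X$. When $\mathcal{F}$ is a topological space, the GDS is very strongly transitive if for every nonempty open $U\subset X$ there exists a compact subset $S\subset\mathcal{F}$ such that $\bigcup_{f\in S}f(U)=X$; topologically mixing if for all nonempty open $U,V\subset X$ there exists a compact subset $S\subset\mathcal{F}$ such that $f(U)\cap V\neq\emptyset$ for all $f\in\mathcal{F}\setminus S$.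
   Formalization: In (ii), ''GDS mixing implies NDDS mixing'' is false for the set F (two points, all f_n the identity); there F is read as the family of f_1^n indexed by n (discrete topology on indices), equal iterates counted separately; for the set F only ''NDDS mixing implies GDS mixing'' is stated. *)

(* Defs.v *)
From mathcomp Require Import all_boot all_classical all_reals topology.

Set Implicit Arguments.
Unset Strict Implicit.
Unset Printing Implicit Defensive.

Local Open Scope classical_set_scope.

(* Time runs over {1, 2, 3, ...}: the value of the sequence at 0 is junk, it is
   never composed and not required to be continuous. *)
Record ndds (X : topologicalType) := Ndds {
  ndds_map :> nat -> X -> X;
  ndds_continuous : forall n, 0 < n -> continuous (ndds_map n) }.

(* [iterate f n] is f_n \o ... \o f_1, i.e. f_1^n, for n >= 1. *)
Fixpoint iterate (X : topologicalType) (f : ndds X) (n : nat) : X -> X :=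
  if n is m.+1 then f m.+1 \o iterate f m else id.

Lemma iterate_continuous (X : topologicalType) (f : ndds X) (n : nat) :
  continuous (iterate f n).
Proof.
elim: n => [|n IHn] x; first exact: cvg_id.
by apply: continuous_comp; [exact: IHn | exact: ndds_continuous].
Qed.

Definition ndds_very_strongly_transitive (X : topologicalType) (f : ndds X) :=
  forall V : set X, open V -> V !=set0 ->
    exists2 k, 0 < k &
      \bigcup_(n in [set n | 0 < n <= k]) (iterate f n @` V) = [set: X].

Definition ndds_topologically_mixing (X : topologicalType) (f : ndds X) :=
  forall U V : set X, open U -> U !=set0 -> open V -> V !=set0 ->
    exists2 k, 0 < k &
      forall n, k <= n -> (iterate f n @` U) `&` V !=set0.

(* A topologized collection of continuous self-maps, given as a family: a map
   may be listed under several indices. A set of maps is the case where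
   [gds_map] is injective. *)
Record gds (X : topologicalType) := Gds {
  gds_index : topologicalType;
  gds_map : gds_index -> X -> X;
  gds_continuous : forall i, continuous (gds_map i) }.

Definition gds_very_strongly_transitive (X : topologicalType) (F : gds X) :=
  forall U : set X, open U -> U !=set0 ->
    exists2 S : set (gds_index F), compact S &
      \bigcup_(i in S) (gds_map i @` U) = [set: X].

Definition gds_topologically_mixing (X : topologicalType) (F : gds X) :=
  forall U V : set X, open U -> U !=set0 -> open V -> V !=set0 ->
    exists2 S : set (gds_index F), compact S &
      forall i, ~ S i -> (gds_map i @` U) `&` V !=set0.

(* {f_1^n : n >= 1} as a set of maps: equal iterates are identified. *)
Definition iterates (X : topologicalType) (f : ndds X) : set (X -> X) :=
  [set iterate f n | n in [set n | 0 < n]].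

Lemma iterates_continuous (X : topologicalType) (f : ndds X)
  (g : discrete_topology (iterates f)) : continuous (val g).
Proof.
case: g => g gf /=; have [n _ <-] := set_mem gf.
exact: iterate_continuous.
Qed.

Definition iterates_gds (X : topologicalType) (f : ndds X) : gds X :=
  Gds (@iterates_continuous X f).

(* {f_1^n : n >= 1} as a family: every n counts. The distinction matters for
   mixing. If all f_n are the identity of a two-point space, the set of iterates
   is a singleton, hence compact, so the set version is vacuously mixing, while
   the non-autonomous system is not mixing. *)
Definition iterates_family_gds (X : topologicalType) (f : ndds X) : gds X :=
  @Gds X (discrete_topology {n : nat | 0 < n}) (fun n => iterate f (val n))
    (fun n => @iterate_continuous X f (val n)).

(* Main.v *)
Require Import Defs.
From mathcomp Require Import all_boot all_classical all_reals topology.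

Local Open Scope classical_set_scope.

(** Compact subsets of a discrete space are finite, so over indices enumerated by time, compact sets
    of maps correspond to initial segments of times. Both systems of iterates are handled at once
    through a surjection [e] from [nat] to the indices with [e n] realizing f_1^(n+1). Transitivity
    and one direction of mixing tolerate repetitions in [e]; returning from the system to the
    sequence for mixing uses injectivity, which the family provides and the set of iterates may
    fail. *)

Lemma discrete_compact_bounded (T : discreteTopologicalType) (S : set T)
    (h : T -> nat) :
  compact S -> exists k, forall i, S i -> h i <= k.
Proof.
move=> /compact_near_coveringP cS.
(* Compactness as near-covering along k going to infinity: [h i <= k] holds on the open singleton of
   [i] once [k] reaches [h i], hence on all of [S] for some [k]. *)
have [|k _ Sk] := cS nat \oo (fun k i => h i <= k) _.
  move=> i _; exists ([set i], [set k | h i <= k]) => /=.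
    by split; [exact: discrete_set1 | exists (h i)].
  by case=> j k /= [-> ].
by exists k => i; apply: Sk => /=.
Qed.

Section enumerated_discrete_gds.
Variables (X : topologicalType) (f : ndds X) (T : discreteTopologicalType).
Variables (m : T -> X -> X) (cm : forall i, continuous (m i)) (e : nat -> T).
Hypothesis me : forall n, m (e n) = iterate f n.+1.
Hypothesis e_surj : forall i, exists n, e n = i.

(** Only the union of the images matters, so one time per index suffices. *)
Lemma very_strongly_transitive_enum :
  ndds_very_strongly_transitive f <-> gds_very_strongly_transitive (Gds cm).
Proof.
split=> [fT V oV V0|FT V oV V0].
  have [k _ Vk] := fT V oV V0; exists (e @` `I_k).
    exact/finite_compact/finite_image/finite_II.
  apply/seteqP; split=> // y _.
  have [[//|n] /= nk Vy] : (\bigcup_(n in [set n | 0 < n <= k])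
    (iterate f n @` V)) y by rewrite Vk.
  by exists (e n); [exists n | rewrite /= me].
(* [h] selects one time for each index; as [e n] stands for time n+1, a bound [k] on [h] over [S]
   becomes [k.+1]. *)
have [h he] := choice e_surj.
have [S cS SV] := FT V oV V0.
have [k Sk] := @discrete_compact_bounded T S h cS; exists k.+1 => //.
apply/seteqP; split=> // y _.
have [i Si Vy] : (\bigcup_(i in S) (m i @` V)) y by rewrite SV.
by exists (h i).+1; [exact: Sk | rewrite -me he].
Qed.

(** An index missed by the first [k] values of [e] can only come from times beyond [k]. *)
Lemma topologically_mixing_enum :
  ndds_topologically_mixing f -> gds_topologically_mixing (Gds cm).
Proof.
move=> fM U V oU U0 oV V0; have [k _ UVk] := fM U V oU U0 oV V0.
exists (e @` `I_k); first exact/finite_compact/finite_image/finite_II.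
move=> i; have [n <-] := e_surj i => Sn /=; rewrite me.
apply: UVk; apply: leqW; rewrite leqNgt; apply/negP => nk.
by apply: Sn; exists n.
Qed.

(* Without injectivity, a compact set of indices can absorb infinitely many
   times [n]. *)
Lemma topologically_mixing_enum_inj : injective e ->
  gds_topologically_mixing (Gds cm) -> ndds_topologically_mixing f.
Proof.
move=> e_inj FM U V oU U0 oV V0; have [S cS UVS] := FM U V oU U0 oV V0.
have [h he] := choice e_surj.
(* Time n+1 >= k+2 forces n > k, and injectivity gives [h (e n) = n], so [e n] lies outside [S]. *)
have [k Sk] := @discrete_compact_bounded T S h cS; exists k.+2 => //.
case=> // n; rewrite ltnS => kn; rewrite -me; apply: UVS => /Sk.
by rewrite (e_inj _ _ (he (e n))) leqNgt kn.
Qed.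

End enumerated_discrete_gds.

Lemma iterates_succ (X : topologicalType) (f : ndds X) (n : nat) :
  iterate f n.+1 \in iterates f.
Proof. by apply/mem_set; exists n.+1. Qed.

Theorem theorem4p9 (R : realType) (X : metricType R) (cX : compact [set: X])
    (f : ndds X) :
  ((ndds_very_strongly_transitive f <->
      gds_very_strongly_transitive (iterates_gds f)) /\
   (ndds_very_strongly_transitive f <->
      gds_very_strongly_transitive (iterates_family_gds f))) /\
  ((ndds_topologically_mixing f ->
      gds_topologically_mixing (iterates_gds f)) /\
   (ndds_topologically_mixing f <->
      gds_topologically_mixing (iterates_family_gds f))).
Proof.
pose e n : discrete_topology (iterates f) := 
  exist (fun g => g \in iterates f) _ (iterates_succ X f n).
have e_surj i : exists n, e n = i.
  case: i => g gf; have [[//|n] _ gE] := set_mem gf.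
  by exists n; apply: val_inj.
pose e' n : discrete_topology {n : nat | 0 < n} := 
  exist (fun n => 0 < n) n.+1 (ltn0Sn n).
have e'_surj i : exists n, e' n = i.
  by case: i => -[//|n] n0; exists n; apply: val_inj.
have e'_inj : injective e' by move=> n p [].
split; split.
- exact: (very_strongly_transitive_enum _ _ _ _ _ e).
- exact: (very_strongly_transitive_enum _ _ _ _ _ e').
- exact: (topologically_mixing_enum _ _ _ _ _ e).
- split; first exact: (topologically_mixing_enum _ _ _ _ _ e').
  exact: (topologically_mixing_enum_inj _ _ _ _ _ e').
Qed.
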